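(* Let $m\in\mathbb N$ and let $(W_i)_{i\in\mathbb N}$ be a countable family of prefix-independent $\Sigma_2^0$ objectives $W_i\subseteq C^\omega$, each having $\varepsilon$-memory $\le m$. Then $\bigcup_{i\in\mathbb N}W_i$ has $\varepsilon$-memory $\le m$.
   Context: An objective $W\subseteq C^\omega$ is $\Sigma_2^0$ if there is a language $L\subseteq C^*$ such that $W=\{w\in C^\omega: w\text{ has only finitely many prefixes in }L\}$. It is prefix-independent if $uw\in W\iff w\in W$ for all $u\in C^*$, $w\in C^\omega$. $\varepsilon$-memory: let $\varepsilon\notin C$; $W^\varepsilon$ is the set of $w\in(C\sqcup\{\varepsilon\})^\omega$ whose $\varepsilon$-free projection $w_C$ is infinite and in $W$, or finite with some $w'\in C^\omega$ such that $w_Cw'\in W$. A game is $(G,V_{\mathrm{Eve}},v_0,W^\varepsilon)$ with $G$ a $(C\sqcup\{\varepsilon\})$-graph (vertices, coloured directed edges $v\xrightarrow{c}v'$, no sinks). A strategy is $(S,\pi,s_0)$ with $S$ a graph, $\pi:S\to G$ an edge/colour-preserving map, $\pi(s_0)=v_0$, such that for $v\notin V_{\mathrm{Eve}}$, $v\xrightarrow{c}v'\in E(G)$, $s\in\pi^{-1}(v)$ there is $s'\in\pi^{-1}(v')$ with $s\xrightarrow{c}s'$; it is winning if every infinite path from $s_0$ has colour sequence in $W^\varepsilon$. An $\varepsilon$-strategy has $V(S)\subseteq V(G)\times M$, $\pi(v,m)=v$ and $\varepsilon$-edges preserving the $M$-component; its memory is $|M|$. $W$ has $\varepsilon$-memory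 $\le m$ if every such game admitting a winning strategy admits a winning $\varepsilon$-strategy of memory $\le m$. *)

(* Defs.v *)
From mathcomp Require Import all_boot.
Set Implicit Arguments. Unset Strict Implicit. Unset Printing Implicit Defensive.

Fixpoint prepend (C : Type) (u : seq C) (w : nat -> C) : nat -> C :=
  match u with
  | [::] => w
  | a :: u' => fun n => match n with 0 => a | k.+1 => prepend u' w k end
  end.

(* W is Sigma_2^0: there is L ⊆ C^* with W = {w | w has finitely many prefixes in L}.
   The prefixes of w are the words mkseq w n, n ∈ ℕ (pairwise distinct), so
   "finitely many prefixes in L" means: eventually no prefix is in L. *)
Definition Sigma02 (C : Type) (W : (nat -> C) -> Prop) : Prop :=
  exists L : seq C -> Prop,
    forall w, W w <-> exists N, forall n, N <= n -> ~ L (mkseq w n).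

Definition prefix_independent (C : Type) (W : (nat -> C) -> Prop) : Prop :=
  forall (u : seq C) (w : nat -> C), W (prepend u w) <-> W w.

(* The letter eps is encoded as None, colours c as Some c. *)

Definition fproj (C : Type) (w : nat -> option C) (n : nat) : seq C :=
  pmap id (mkseq w n).

Definition inf_noneps (C : Type) (w : nat -> option C) : Prop :=
  forall N, exists n, N <= n /\ w n <> None.

(* W^eps: the eps-free projection w_C is infinite and in W, or it is finite
   and can be extended by some w' ∈ C^omega into W. In the infinite case, v is
   the projection iff every finite projection of a prefix is a prefix of v. *)
Definition Weps (C : Type) (W : (nat -> C) -> Prop) (w : nat -> option C) : Prop :=
  (inf_noneps w /\
     exists v : nat -> C,
       (forall n, fproj w n = mkseq v (size (fproj w n))) /\ W v)
  \/
  (exists N, (forall n, N <= n -> w n = None) /\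
     exists w' : nat -> C, W (prepend (fproj w N) w')).

Record graph (A : Type) := Graph {
  vert :> Type;
  edge : vert -> A -> vert -> Prop;
  no_sink : forall v, exists a v', edge v a v'
}.
Arguments edge {A g} _ _ _.

Definition is_strategy (A : Type) (G : graph A) (VE : G -> Prop) (v0 : G)
  (S : graph A) (pi : S -> G) (s0 : S) : Prop :=
  [/\ forall s a s', edge s a s' -> edge (pi s) a (pi s'),
      pi s0 = v0 &
      forall (v : G) (a : A) (v' : G), ~ VE v -> edge v a v' ->
        forall s : S, pi s = v -> exists s' : S, pi s' = v' /\ edge s a s'].

Definition winning (A : Type) (S : graph A) (s0 : S) (Obj : (nat -> A) -> Prop) : Prop :=
  forall (p : nat -> S) (c : nat -> A),
    p 0 = s0 -> (forall n, edge (p n) (c n) (p n.+1)) -> Obj c.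

(* existence of a winning eps-strategy with memory <= m in the game
   (G, VE, v0, W^eps): vertex set of S is a subset {x | P x} of V(G) x M,
   pi (v, m) = v, and eps-edges preserve the memory component. *)
Definition has_winning_eps_strategy (C : Type) (W : (nat -> C) -> Prop)
  (G : graph (option C)) (VE : G -> Prop) (v0 : G) (m : nat) : Prop :=
  exists (M : finType) (P : (G * M)%type -> Prop)
         (ES : {x | P x} -> option C -> {x | P x} -> Prop)
         (hns : forall s, exists a s', ES s a s')
         (s0 : {x | P x}),
    let S := @Graph (option C) {x | P x} ES hns in
    [/\ #|M| <= m,
        @is_strategy (option C) G VE v0 S (fun s : S => (proj1_sig s).1) (s0 : S),
        (forall s s' : S, edge s None s' -> (proj1_sig s).2 = (proj1_sig s').2) &
        @winning (option C) S (s0 : S) (Weps W)].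

Definition eps_memory_le (C : Type) (W : (nat -> C) -> Prop) (m : nat) : Prop :=
  forall (G : graph (option C)) (VE : G -> Prop) (v0 : G),
    (exists (S : graph (option C)) (pi : S -> G) (s0 : S),
        is_strategy VE v0 pi s0 /\ winning s0 (Weps W)) ->
    has_winning_eps_strategy W VE v0 m.

(* Main.v *)
Require Import Defs.
From mathcomp Require Import all_boot.
From mathcomp Require Import boolp classical_sets.

(* Fix a winning strategy S for the union, mapped by pi to the game, and write
   s =c=> s' if S has a path from s to s' whose colours are epsilons followed by
   c. By Zorn's lemma there is a maximal winning epsilon-strategy sigma with
   memory m, where the play may start from any position of sigma. It covers pi(s)
   for every winning state s of S:

   Otherwise let A be the set of the winning states that sigma does not cover. By
   a Baire category argument there are l in A and i such that all =c=>-paths from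
   l inside A satisfy W i. Say that s represents v if s reaches a preimage of v
   by epsilon-edges. Consider the game in which Eve, at a vertex v, commits to a
   state s in A that represents v, after which Adam picks a step s =c=> s' inside
   A, or moves silently to any vertex that s represents. Eve wins W i from pi(l),
   hence does so with an epsilon-strategy of memory m. Playing by it in the
   original game either satisfies W i or leaves A, and then sigma takes over. This
   extends sigma to pi(l), a contradiction.

   Committing to s rather than to the preimage of v makes this sound for
   epsilon-moves, which must keep the memory: they stay within the moves of s. *)

Set Implicit Arguments.
Unset Strict Implicit.
Unset Printing Implicit Defensive.

Local Open Scope classical_set_scope.

(** * Infinite words *)

Section Words.
Variable A : Type.
Implicit Types (u : nat -> seq A) (w : nat -> A).

Lemma mkseqD w m n :
  mkseq w (m + n) = mkseq w m ++ mkseq (fun k => w (m + k)) n.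
Proof.
rewrite /mkseq iotaD map_cat add0n.
by rewrite -[in iota m n](addn0 m) iotaDl -map_comp.
Qed.

Lemma mkseq_prepend (l : seq A) w n :
  mkseq (prepend l w) (size l + n) = l ++ mkseq w n.
Proof. by elim: l => //= a l IHl; rewrite addSn -add1n mkseqD -IHl. Qed.

Lemma word_limit u :
  (forall n, exists l, u n.+1 = u n ++ l) ->
  (forall k, exists n, k < size (u n)) ->
  exists w, forall n, u n = mkseq w (size (u n)).
Proof.
move=> /choice[l uS] /choice[N kN].
have prefix_u m n : m <= n -> exists r, u n = u m ++ r.
  move/subnK <-; elim: (n - m) => [|j [r IHj]].
    by exists [::]; rewrite cats0.
  by exists (r ++ l (j + m)); rewrite addSn uS IHj catA.
have [a _] : exists a : A, True.
  by move: (kN 0); case: (u (N 0)) => // a; exists a.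
exists (fun k => nth a (u (N k)) k) => n.
apply: (@eq_from_nth _ a) => [|k kn]; first by rewrite size_mkseq.
rewrite nth_mkseq //; have [nN|/ltnW Nn] := leqP n (N k).
  by have [r ->] := prefix_u _ _ nN; rewrite nth_cat kn.
by have [r ->] := prefix_u _ _ Nn; rewrite nth_cat kN.
Qed.

Definition growing u := forall n, exists l, 0 < size l /\ u n.+1 = u n ++ l.

Lemma growing_size u n : growing u -> n <= size (u n).
Proof.
move=> growu; elim: n => // n IHn; have [l [l_gt0 ->]] := growu n.
by rewrite size_cat -addn1 leq_add.
Qed.

End Words.

Lemma logn2_unbounded i N : exists n, N <= n /\ logn 2 n = i.
Proof.
exists (2 ^ i * N.*2.+1); split.
  rewrite (@leq_trans N.*2.+1) ?leq_pmull ?expn_gt0 //.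
  by rewrite -addnn -addnS leq_addr.
rewrite lognM ?expn_gt0 // pfactorK // (@logn_coprime 2) ?addn0 //.
by rewrite coprime2n /= odd_double.
Qed.

Section EpsProjection.
Variable C : Type.
Implicit Types (d e : nat -> option C) (v : nat -> C) (W : (nat -> C) -> Prop).

Definition is_proj e v := forall n, fproj e n = mkseq v (size (fproj e n)).

Lemma fprojD e m n :
  fproj e (m + n) = fproj e m ++ fproj (fun k => e (m + k)) n.
Proof. by rewrite /fproj mkseqD pmap_cat. Qed.

Lemma fprojS e n : fproj e n.+1 = fproj e n ++ pmap id [:: e n].
Proof. by rewrite /fproj mkseqS -cats1 pmap_cat. Qed.

Lemma leq_size_fproj e m n : m <= n -> size (fproj e m) <= size (fproj e n).
Proof. by move/subnKC <-; rewrite fprojD size_cat leq_addr. Qed.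

Lemma inf_nonepsP e : inf_noneps e <-> forall k, exists n, k < size (fproj e n).
Proof.
split=> [inf|unbounded N].
  have grow n : exists m, size (fproj e n) < size (fproj e m).
    have [m [nm em]] := inf n; exists m.+1.
    rewrite (leq_ltn_trans (leq_size_fproj e nm)) // fprojS size_cat.
    by case: (e m) em => // a _; rewrite addn1.
  elim=> [|k [n kn]]; first by have [m] := grow 0; exists m.
  by have [m] := grow n; exists m; apply: leq_ltn_trans kn _.
have [n] := unbounded (size (fproj e N)); elim: n => // n IHn.
have [Nn|nN] := leqP N n; last by rewrite ltnNge leq_size_fproj.
rewrite fprojS; case en: (e n) => [a|]; last by rewrite cats0.
by exists n; rewrite en.
Qed.

Lemma is_proj_exists e : inf_noneps e -> exists v, is_proj e v.
Proof.
move=> /inf_nonepsP; apply: word_limit => n.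
by exists (pmap id [:: e n]); exact: fprojS.
Qed.

Lemma is_proj_unique e v v' :
  inf_noneps e -> is_proj e v -> is_proj e v' -> v = v'.
Proof.
move=> /inf_nonepsP unbounded pv pv'; apply/funext => k.
have [n kn] := unbounded k.
by rewrite -(nth_mkseq (v k) v kn) -(nth_mkseq (v k) v' kn) -pv -pv'.
Qed.

Lemma is_proj_cofinal e v :
  (forall n, exists m, n <= m /\ fproj e m = mkseq v (size (fproj e m))) ->
  is_proj e v.
Proof.
move=> cofinal n; have [m [/subnKC <-]] := cofinal n.
rewrite fprojD size_cat mkseqD => /(congr1 (take (size (fproj e n)))).
by rewrite !take_size_cat ?size_mkseq.
Qed.

Lemma Weps_inhabited W e : Weps W e -> exists w, W w.
Proof. by case=> [[_ [v [_ Wv]]]|[N [_ [w Ww]]]]; eexists; eassumption. Qed.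

Lemma Weps_subset W W' e : (forall w, W w -> W' w) -> Weps W e -> Weps W' e.
Proof.
move=> WW' [[inf [v [pv /WW' Wv]]]|[N [eN [w /WW' Ww]]]].
  by left; split=> //; exists v.
by right; exists N; split=> //; exists w.
Qed.

Lemma Weps_proj W e v : inf_noneps e -> is_proj e v -> Weps W e <-> W v.
Proof.
move=> inf pv; split=> [[[_ [v' [pv' Wv']]]|[N [eN _]]]|Wv].
- by rewrite (is_proj_unique inf pv pv').
- by have [n [/eN ->]] := inf N.
- by left; split=> //; exists v.
Qed.

Lemma Weps_eps_tail W e :
  prefix_independent W -> ~ inf_noneps e -> Weps W e <-> exists w, W w.
Proof.
move=> piW /existsNP[N eN]; split=> [|[w Ww]]; first exact: Weps_inhabited.
right; exists N; split=> [n Nn|]; last by exists w; apply/piW.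
by apply: contrapT => en; apply: eN; exists n.
Qed.

Lemma Weps_reindex W d e (t : nat -> nat) :
  prefix_independent W -> (forall n, n <= t n) ->
  (forall n, fproj d (t n) = fproj e n) -> Weps W d <-> Weps W e.
Proof.
move=> piW le_t de.
have inf_de : inf_noneps d <-> inf_noneps e.
  rewrite !inf_nonepsP; split=> unbounded k; have [n kn] := unbounded k.
    by exists n; rewrite -de (leq_trans kn) // leq_size_fproj.
  by exists (t n); rewrite de.
have [inf_e|ninf_e] := EM (inf_noneps e); last first.
  by rewrite !Weps_eps_tail // inf_de.
have [v pv] := is_proj_exists inf_e.
rewrite (Weps_proj _ inf_e pv) (@Weps_proj _ _ v) // ?inf_de //.
by apply: is_proj_cofinal => n; exists (t n); rewrite de -pv.
Qed.

Lemma Weps_shift W e n :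
  prefix_independent W -> Weps W (fun k => e (n + k)) <-> Weps W e.
Proof.
move=> piW; set e' := fun k => _.
have inf_e' : inf_noneps e' <-> inf_noneps e.
  split=> inf N.
    have [m [Nm em]] := inf N; exists (n + m).
    by rewrite (leq_trans Nm) // leq_addl.
  have [m [nNm em]] := inf (n + N); have nm := leq_trans (leq_addr N n) nNm.
  by exists (m - n); rewrite /e' subnKC // leq_subRL.
have [inf|ninf] := EM (inf_noneps e'); last first.
  by rewrite !Weps_eps_tail // -inf_e'.
have [v pv] := is_proj_exists inf.
have pv' : is_proj e (prepend (fproj e n) v).
  apply: is_proj_cofinal => m; exists (n + m); rewrite leq_addl fprojD size_cat.
  by rewrite mkseq_prepend -pv.
by rewrite (Weps_proj _ inf pv) (Weps_proj _ _ pv') ?piW // -inf_e'.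
Qed.

(* [t k] is the position in [e] of the letter [v k] of its projection. *)
Lemma contract_eps_path (T : Type) (Q : T -> C -> T -> Prop) (f : nat -> T) e :
  inf_noneps e ->
  (forall n, if e n is Some c then Q (f n) c (f n.+1) else f n.+1 = f n) ->
  exists (t : nat -> nat) v,
    [/\ f (t 0) = f 0, forall k, Q (f (t k)) (v k) (f (t k.+1)) & is_proj e v].
Proof.
move=> /[dup] /is_proj_exists[v pv] /inf_nonepsP unbounded fe.
have f_const m n : m <= n -> size (fproj e n) = size (fproj e m) -> f n = f m.
  move/subnKC <-; elim: (n - m) => [|j IHj]; first by rewrite addn0.
  rewrite addnS fprojS; have := fe (m + j); case: (e _) => [c _|-> /=].
    have := leq_size_fproj e (leq_addr j m).
    by rewrite size_cat /= addn1 => + E; rewrite -E ltnn.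
  by rewrite cats0.
have letter k : exists n, size (fproj e n) = k /\ e n = Some (v k).
  have [n] := unbounded k; elim: n => // n IHn.
  have := pv n.+1; rewrite fprojS.
  case en: (e n) => [c|]; last by rewrite cats0.
  rewrite size_cat addn1 mkseqS -pv cats1 ltnS leq_eqVlt => /rcons_inj[cv].
  by move=> /predU1P[->|/IHn//]; exists n; rewrite en cv.
have [t /all_and2[size_t e_t]] := choice letter.
have f_eq m n : size (fproj e m) = size (fproj e n) -> f m = f n.
  by move=> mn; case/orP: (leq_total m n) => /f_const; [move=> <-|move=> ->].
exists t, v; split=> // [|k]; first by apply: f_eq; rewrite size_t.
have := fe (t k); rewrite e_t (f_eq (t k).+1 (t k.+1)) //.
by rewrite fprojS e_t size_cat !size_t addn1.
Qed.

End EpsProjection.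

(** * Paths *)

Section Paths.
Variables (X A : Type) (Q : X -> A -> X -> Prop).
Implicit Types (p : nat -> X) (c : nat -> A) (l : seq (A * X)).

Definition infinite_path p c := forall n, Q (p n) (c n) (p n.+1).

Fixpoint trail x l : Prop :=
  if l is s :: l' then Q x s.1 s.2 /\ trail s.2 l' else True.

Lemma trail_cat x l l' :
  trail x (l ++ l') <-> trail x l /\ trail (last x (unzip2 l)) l'.
Proof. by elim: l x => [|s l IHl] x /=; rewrite ?IHl; tauto. Qed.

Lemma last_unzip2_mkseq x (w : nat -> A * X) n :
  last x (unzip2 (mkseq w n)) = if n is k.+1 then (w k).2 else x.
Proof. by case: n => // n; rewrite mkseqS /unzip2 map_rcons last_rcons. Qed.

Lemma trail_mkseq p c n :
  infinite_path p c -> trail (p 0) (mkseq (fun k => (c k, p k.+1)) n).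
Proof.
move=> pc; elim: n => // n IHn; rewrite mkseqS -cats1 trail_cat; split=> //=.
by rewrite last_unzip2_mkseq; split=> //; case: n {IHn} => [|n]; exact: pc.
Qed.

Lemma path_of_trails x (w : nat -> A * X) :
  (forall n, exists m, n <= m /\ trail x (mkseq w m)) ->
  infinite_path (fun n => if n is k.+1 then (w k).2 else x) (fst \o w).
Proof.
move=> trails n; have [m [/subnKC <-]] := trails n.+1.
rewrite mkseqD mkseqS -cats1 !trail_cat => -[[_ [wn _]] _].
by rewrite last_unzip2_mkseq in wn.
Qed.

Lemma limit_path x (u : nat -> seq (A * X)) :
  growing u -> (forall n, trail x (u n)) ->
  exists p c, [/\ p 0 = x, infinite_path p c &
    forall n, mkseq c (size (u n)) = unzip1 (u n)].
Proof.
move=> growu trailu; have [| |w wu] := word_limit (u := u).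
- by move=> n; have [l [_ ->]] := growu n; exists l.
- by move=> k; exists k.+1; exact: growing_size.
exists (fun n => if n is k.+1 then (w k).2 else x), (fst \o w); split=> // [|n].
  apply: path_of_trails => n; exists (size (u n)).
  by rewrite growing_size // -wu.
by rewrite [in RHS]wu /unzip1 /mkseq -map_comp.
Qed.

End Paths.

Lemma trail_extension (T C : Type) (Q : T -> C -> T -> Prop)
    (W : (nat -> C) -> Prop) (L : seq C -> Prop) (x : T) u p c :
  prefix_independent W ->
  (forall w, (exists N, forall n, N <= n -> ~ L (mkseq w n)) -> W w) ->
  trail Q x u -> p 0 = last x (unzip2 u) -> infinite_path Q p c -> ~ W c ->
  exists l, [/\ 0 < size l, trail Q x (u ++ l) & L (unzip1 (u ++ l))].
Proof.
move=> piW finL trailu p0 pc nWc; apply: contrapT => none; apply: nWc.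
apply/(piW (unzip1 u))/finL; exists (size u).+1 => n un Ln; apply: none.
exists (mkseq (fun k => (c k, p k.+1)) (n - size u)); split.
- by rewrite size_mkseq subn_gt0.
- by apply/trail_cat; split=> //; rewrite -p0; exact: trail_mkseq.
- move: Ln; rewrite -[in X in X -> _](subnKC (ltnW un)) -(size_map fst u).
  by rewrite mkseq_prepend /unzip1 map_cat /mkseq -map_comp.
Qed.

(* Baire category: otherwise every trail extends, for every [i], to a trail
   whose colours belong to a language witnessing that [W i] is Sigma_2^0. Doing
   so infinitely often for each [i] yields a path outside all the [W i]. *)
Lemma uniform_vertex (T C : Type) (Q : T -> C -> T -> Prop)
    (W : nat -> (nat -> C) -> Prop) (x : T) :
  (forall i, prefix_independent (W i)) -> (forall i, Sigma02 (W i)) ->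
  (exists w i, W i w) -> (forall p c, infinite_path Q p c -> exists i, W i c) ->
  exists s i, (exists w, W i w) /\
    forall p c, p 0 = s -> infinite_path Q p c -> W i c.
Proof.
move=> piW /choice[L LP] [w [j Wjw]] winQ.
suff [s [i win_s]] : exists s i,
    forall p c, p 0 = s -> infinite_path Q p c -> W i c.
  have [neWi|emptyWi] := EM (exists w', W i w'); first by exists s, i.
  exists s, j; split=> [|p c p0 pc]; first by exists w.
  by case: emptyWi; exists c; exact: win_s p0 pc.
apply: contrapT => not_uniform.
have /choice[ext extP] (iu : nat * seq (C * T)) : exists l, trail Q x iu.2 ->
    [/\ 0 < size l, trail Q x (iu.2 ++ l) & L iu.1 (unzip1 (iu.2 ++ l))].
  case: iu => i u; have [trailu|] := EM (trail Q x u); last by exists [::].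
  apply: contrapT => no_ext; apply: not_uniform.
  exists (last x (unzip2 u)), i => p c p0 pc; apply: contrapT => nWc.
  have [v|l lP] := trail_extension (L := L i) (piW i) _ trailu p0 pc nWc.
    exact: (LP i v).2.
  by apply: no_ext; exists l.
pose u n := iteri n (fun k l => l ++ ext (logn 2 k, l)) [::].
have trailu n : trail Q x (u n).
  by elim: n => // n IHn; have [] := extP (logn 2 n, u n) IHn.
have growu : growing u.
  move=> n; exists (ext (logn 2 n, u n)); split=> //.
  by have [] := extP (logn 2 n, u n) (trailu n).
have [p [c [_ pc cu]]] := limit_path growu trailu.
have [i /LP[N noL]] := winQ p c pc; have [n [Nn ni]] := logn2_unbounded i N.
apply: (noL (size (u n.+1))).
  exact: leq_trans Nn (ltnW (growing_size n.+1 growu)).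
by rewrite cu -ni; have [] := extP (logn 2 n, u n) (trailu n).
Qed.

(** * Steps of an epsilon-graph *)

Section EpsGraph.
Variables (C : Type) (S : graph (option C)).
Implicit Types (s d : S) (W : (nat -> C) -> Prop).

Inductive eps_reach s : S -> Prop :=
| eps_refl : eps_reach s s
| eps_step d d' : eps_reach s d -> edge d None d' -> eps_reach s d'.

Definition cstep s c s' := exists2 d, eps_reach s d & edge d (Some c) s'.

Lemma eps_reach_trail s d : eps_reach s d ->
  exists l, [/\ trail edge s l, last s (unzip2 l) = d &
    pmap id (unzip1 l) = [::]].
Proof.
elim=> [|{}d d' _ [l [sl ld cl]] dd']; first by exists [::].
exists (l ++ [:: (None, d')]); split.
- by apply/trail_cat; rewrite ld.
- by rewrite /unzip2 map_cat last_cat.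
- by rewrite /unzip1 map_cat pmap_cat cl.
Qed.

Lemma cstep_trail s c s' : cstep s c s' ->
  exists l, [/\ 0 < size l, trail edge s l, last s (unzip2 l) = s' &
    pmap id (unzip1 l) = [:: c]].
Proof.
move=> [d /eps_reach_trail[l [sl ld cl]] ds'].
exists (l ++ [:: (Some c, s')]); split.
- by rewrite size_cat addn1.
- by apply/trail_cat; rewrite ld.
- by rewrite /unzip2 map_cat last_cat.
- by rewrite /unzip1 map_cat pmap_cat cl.
Qed.

Lemma winning_cstep_path W s p c :
  winning s (Weps W) -> p 0 = s -> infinite_path cstep p c -> W c.
Proof.
move=> win p0 pc; have /choice[l lP] n := cstep_trail (pc n).
pose u n := flatten (mkseq l n).
have uS n : u n.+1 = u n ++ l n by rewrite /u mkseqS flatten_rcons.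
have growu : growing u by move=> n; exists (l n); split=> //; case: (lP n).
have trailu n : trail edge s (u n) /\ last s (unzip2 (u n)) = p n.
  elim: n => // n [IHtrail IHlast]; have [_ sl sl_last _] := lP n.
  by rewrite uS trail_cat /unzip2 map_cat last_cat -/unzip2 IHlast.
have coloursu n : pmap id (unzip1 (u n)) = mkseq c n.
  elim: n => // n IHn; have [_ _ _ cl] := lP n.
  by rewrite uS /unzip1 map_cat pmap_cat IHn cl mkseqS cats1.
have [q [e [q0 qe eu]]] := limit_path growu (fun n => (trailu n).1).
have fproju n : fproj e (size (u n)) = mkseq c n by rewrite /fproj eu.
have inf : inf_noneps e.
  by apply/inf_nonepsP => k; exists (size (u k.+1)); rewrite fproju size_mkseq.
apply/(Weps_proj W inf (v := c)); last exact: win q0 qe.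
apply: is_proj_cofinal => n; exists (size (u n)).
by rewrite growing_size // fproju size_mkseq.
Qed.

Lemma winning_edge W s a s' :
  prefix_independent W -> winning s (Weps W) -> edge s a s' ->
  winning s' (Weps W).
Proof.
move=> piW win ss' p e p0 pe.
pose e' n := if n is k.+1 then e k else a.
apply/(Weps_shift e' 1 piW)/(win (fun n => if n is k.+1 then p k else s)) => //.
by case=> [|n] /=; rewrite ?p0.
Qed.

Lemma winning_cstep W s c s' :
  prefix_independent W -> winning s (Weps W) -> cstep s c s' ->
  winning s' (Weps W).
Proof.
move=> piW win [d sd]; apply: winning_edge => //.
by elim: sd => // d1 d2 _ + d12; move=> win1; exact: winning_edge d12.
Qed.

Lemma infinite_path_exists s :
  exists p c, p 0 = s /\ infinite_path (@edge _ S) p c.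
Proof.
have /choice[next nextP] (t : S) : exists ay, edge t ay.1 ay.2.
  by have [a [y ty]] := no_sink t; exists (a, y).
pose p n := iter n (fun t => (next t).2) s.
by exists p, (fun n => (next (p n)).1); split=> // n; exact: nextP.
Qed.

Lemma winning_inhabited W s : winning s (Weps W) -> exists w, W w.
Proof.
have [p [c [p0 pc]]] := infinite_path_exists s.
by move=> /(_ p c p0 pc)/Weps_inhabited.
Qed.

End EpsGraph.

(** * Strategies with memory *)

(* Plays that reach [exit] are not required to win: there another strategy is
   supposed to take over. *)
Record eps_strategy (C M : Type) (W : (nat -> C) -> Prop) (G : graph (option C))
    (VE : G -> Prop) (exit : set (G * M)) := EpsStrategy {
  pos : set (G * M);
  plays : G * M -> option C -> G * M -> Prop;
  plays_pos : forall x a y, pos x -> plays x a y -> pos y \/ exit y;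
  plays_edge : forall x a y, pos x -> plays x a y -> edge x.1 a y.1;
  plays_eps : forall x y, pos x -> plays x None y -> x.2 = y.2;
  plays_exists : forall x, pos x -> exists a y, plays x a y;
  plays_adam : forall x a v, pos x -> ~ VE x.1 -> edge x.1 a v ->
    exists k, plays x a (v, k);
  plays_wins : forall q e, (forall n, pos (q n) /\ ~ exit (q n)) ->
    infinite_path plays q e -> Weps W e } as sigma.

Notation closed_strategy M W VE := (@eps_strategy _ M W _ VE set0).

Section EpsStrategy.
Variables (C : Type) (W : (nat -> C) -> Prop).
Variables (G : graph (option C)) (VE : G -> Prop).

Lemma winning_from_pos (M : Type) (sigma : closed_strategy M W VE)
    (E : G * M -> option C -> G * M -> Prop) q e :
  (forall x a y, pos sigma x -> E x a y -> plays sigma x a y) ->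
  pos sigma (q 0) -> infinite_path E q e -> Weps W e.
Proof.
move=> E_sub q0 qe; have qpos n : pos sigma (q n).
  elim: n => // n IHn.
  by have [|[]] := plays_pos IHn (E_sub _ _ _ IHn (qe n)).
apply: (plays_wins (sigma := sigma) (q := q)) => n; last exact: E_sub.
by split=> // -[].
Qed.

Lemma has_winning_eps_strategy_of_pos (M : finType)
    (sigma : closed_strategy M W VE) (v : G) (k : M) (m : nat) :
  #|M| <= m -> pos sigma (v, k) -> has_winning_eps_strategy W VE v m.
Proof.
move=> leM posv; pose state := {x | pos sigma x}.
pose E (s : state) a (s' : state) := plays sigma (sval s) a (sval s').
have succ (s : state) a y : plays sigma (sval s) a y ->
    exists2 s' : state, sval s' = y & E s a s'.
  move=> sy; have [py|[]] := plays_pos (svalP s) sy.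
  by exists (exist _ y py).
have E_exists s : exists a s', E s a s'.
  have [a [y /succ[s' _ ss']]] := plays_exists (svalP s).
  by exists a, s'.
exists M, (pos sigma), E, E_exists, (exist _ (v, k) posv); split=> //.
- split=> //= [s a s' /(plays_edge (svalP s))//|u a v' + + s su].
  rewrite -{}su => nE sv'.
  have [k' /succ[s' s'v ss']] := plays_adam (svalP s) nE sv'.
  by exists s'; rewrite s'v.
- by move=> s s'; exact: plays_eps (svalP s).
- move=> p c p0 pc.
  apply: (@winning_from_pos _ sigma (plays sigma) (sval \o p)) => //.
  by rewrite /= p0.
Qed.

Hypothesis piW : prefix_independent W.

Lemma eps_strategy_of_injection (M : Type) (v : G) (S : graph (option C))
    (key : S -> G * M) (s0 : S) :
  injective key -> is_strategy VE v (fst \o key) s0 ->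
  (forall s s' : S, edge s None s' -> (key s).2 = (key s').2) ->
  winning s0 (Weps W) ->
  exists sigma : closed_strategy M W VE, pos sigma (key s0).
Proof.
move=> key_inj [hom _ adam] epsM win0.
pose P x := exists s, key s = x /\ winning s (Weps W).
pose E x a y := exists s s', [/\ key s = x, key s' = y & edge s a s'].
have E_pos x a y : P x -> E x a y -> P y \/ set0 y.
  move=> [s [<- win]] [_ [s' [/key_inj -> <- ss']]].
  by left; exists s'; split=> //; exact: winning_edge ss'.
have E_edge x a y : P x -> E x a y -> edge x.1 a y.1.
  by move=> _ [s [s' [<- <- ss']]]; exact: hom.
have E_eps x y : P x -> E x None y -> x.2 = y.2.
  by move=> _ [s [s' [<- <- ss']]]; exact: epsM.
have E_exists x : P x -> exists a y, E x a y.
  move=> [s [<- _]]; have [a [s' ss']] := no_sink s.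
  by exists a, (key s'), s, s'.
have E_adam x a w : P x -> ~ VE x.1 -> edge x.1 a w -> exists k, E x a (w, k).
  move=> [s [<- _]] nE sw; have [s' [<- ss']] := adam _ _ _ nE sw s erefl.
  by exists (key s').2, s, s'; split=> //; exact: surjective_pairing.
have E_wins q e : (forall n, P (q n) /\ ~ set0 (q n)) ->
    infinite_path E q e -> Weps W e.
  move=> qP qe; have [p /all_and2[pq winp]] := choice (fun n => (qP n).1).
  apply: (winp 0 p) => // n; have [s [s' [sq s'q ss']]] := qe n.
  by rewrite (key_inj (p n) s) 1?(key_inj (p n.+1) s') ?pq.
by exists (EpsStrategy E_pos E_edge E_eps E_exists E_adam E_wins); exists s0.
Qed.

Lemma eps_strategy_of_has_winning v m : has_winning_eps_strategy W VE v m ->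
  exists (sigma : closed_strategy 'I_m W VE) k, pos sigma (v, k).
Proof.
move=> [M [P [E [E_exists [s0 [leM strat epsM win]]]]]].
have [_ s0v _] := strat.
pose key (s : {x | P x}) := ((sval s).1, widen_ord leM (enum_rank (sval s).2)).
have [| | | |sigma sigma0] :=
  @eps_strategy_of_injection 'I_m v (Graph E_exists) key s0.
- move=> [[v1 k1] P1] [[v2 k2] P2] [/= ev /ord_inj/enum_rank_inj ek].
  by apply: eq_exist; rewrite ev ek.
- by [].
- by move=> s s' /epsM ss'; rewrite /key ss'.
- by [].
by exists sigma, (key s0).2; rewrite -s0v.
Qed.

End EpsStrategy.

Section Extension.
Variables (C M : Type) (W : (nat -> C) -> Prop).
Variables (G : graph (option C)) (VE : G -> Prop).
Implicit Types (sigma tau rho : closed_strategy M W VE) (x y : G * M).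

Definition extends sigma tau := forall x, pos sigma x ->
  pos tau x /\ forall a y, plays sigma x a y <-> plays tau x a y.

Lemma extends_refl sigma : extends sigma sigma.
Proof. by move=> x sx. Qed.

Lemma extends_trans sigma tau rho :
  extends sigma tau -> extends tau rho -> extends sigma rho.
Proof.
move=> st tr x /st[/tr[rx tr_plays] st_plays]; split=> // a y.
by rewrite st_plays tr_plays.
Qed.

Lemma chain_upper_bound (F : set (closed_strategy M W VE)) :
  total_on F extends -> exists tau, forall sigma, F sigma -> extends sigma tau.
Proof.
move=> chainF.
pose P x := exists sigma, F sigma /\ pos sigma x.
pose E x a y := exists sigma, [/\ F sigma, pos sigma x & plays sigma x a y].
have E_agree sigma x a y :
    F sigma -> pos sigma x -> E x a y <-> plays sigma x a y.
  move=> Fs sx; split=> [[tau [Ft tx txy]]|sxy]; last by exists sigma.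
  by have [/(_ x sx)[_ ->]|/(_ x tx)[_ <-]] := chainF _ _ Fs Ft.
have E_pos x a y : P x -> E x a y -> P y \/ set0 y.
  move=> _ [sigma [Fs sx sxy]]; have [sy|//] := plays_pos sx sxy.
  by left; exists sigma.
have E_edge x a y : P x -> E x a y -> edge x.1 a y.1.
  by move=> _ [sigma [_ sx /(plays_edge sx)]].
have E_eps x y : P x -> E x None y -> x.2 = y.2.
  by move=> _ [sigma [_ sx /(plays_eps sx)]].
have E_exists x : P x -> exists a y, E x a y.
  move=> [sigma [Fs sx]]; have [a [y sxy]] := plays_exists sx.
  by exists a, y, sigma.
have E_adam x a v : P x -> ~ VE x.1 -> edge x.1 a v -> exists k, E x a (v, k).
  move=> [sigma [Fs sx]] nE xv; have [k sxk] := plays_adam sx nE xv.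
  by exists k, sigma.
have E_wins q e : (forall n, P (q n) /\ ~ set0 (q n)) ->
    infinite_path E q e -> Weps W e.
  move=> Pq; have [[sigma [Fs s0]] _] := Pq 0.
  by apply: (winning_from_pos _ s0) => x a y sx /(E_agree _ _ _ _ Fs sx).
exists (EpsStrategy E_pos E_edge E_eps E_exists E_adam E_wins) => sigma Fs x sx.
by split=> [|a y]; [exists sigma | apply: iff_sym; exact: E_agree].
Qed.

Lemma maximal_eps_strategy :
  exists sigma, forall tau, extends sigma tau ->
    forall x, pos tau x -> pos sigma x.
Proof.
have [empty _] : exists tau, forall sigma, set0 sigma -> extends sigma tau.
  exact: chain_upper_bound.
pose R sigma tau := `[< extends sigma tau >].
have [| | |sigma max_sigma] := ZL_preorder empty (R := R).
- by move=> sigma; exact/asboolP/extends_refl.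
- move=> rho sigma tau /asboolP rs /asboolP st.
  exact/asboolP/(extends_trans rs st).
- move=> F chainF; have [|tau tauP] := @chain_upper_bound F.
    move=> sigma tau Fs Ft.
    by have [/asboolP|/asboolP] := chainF _ _ Fs Ft; auto.
  by exists tau => sigma Fs; exact/asboolP/tauP.
exists sigma => tau /asboolP/max_sigma/asboolP tau_sigma x tx.
by have [] := tau_sigma x tx.
Qed.

Lemma eps_strategy_amalgam W' sigma (tau : eps_strategy W' VE (pos sigma)) :
  prefix_independent W -> (forall w, W' w -> W w) ->
  exists rho, extends sigma rho /\ forall x, pos tau x -> pos rho x.
Proof.
move=> piW W'W.
pose P x := pos sigma x \/ ~ pos sigma x /\ pos tau x.
pose E x a y :=
  pos sigma x /\ plays sigma x a y \/ ~ pos sigma x /\ plays tau x a y.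
have tau_P x : pos tau x -> P x.
  by have [sx|nsx] := EM (pos sigma x); [left | right].
have E_pos x a y : P x -> E x a y -> P y \/ set0 y.
  move=> [sx|[nsx tx]] [[sx' xy]|[nsx' xy]] //; left.
  - by have [|] := plays_pos sx xy; left.
  - by have [/tau_P//|sy] := plays_pos tx xy; left.
have E_edge x a y : P x -> E x a y -> edge x.1 a y.1.
  by move=> [sx|[nsx tx]] [[sx' xy]|[nsx' xy]] //; exact: (plays_edge _ xy).
have E_eps x y : P x -> E x None y -> x.2 = y.2.
  by move=> [sx|[nsx tx]] [[sx' xy]|[nsx' xy]] //; exact: (plays_eps _ xy).
have E_exists x : P x -> exists a y, E x a y.
  move=> [sx|[nsx tx]].
    by have [a [y xy]] := plays_exists sx; exists a, y; left.
  by have [a [y xy]] := plays_exists tx; exists a, y; right.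
have E_adam x a v : P x -> ~ VE x.1 -> edge x.1 a v -> exists k, E x a (v, k).
  move=> [sx|[nsx tx]] nE xv.
    by have [k xk] := plays_adam sx nE xv; exists k; left.
  by have [k xk] := plays_adam tx nE xv; exists k; right.
have E_wins q e : (forall n, P (q n) /\ ~ set0 (q n)) ->
    infinite_path E q e -> Weps W e.
  move=> Pq qe; have [[N sN]|nsq] := EM (exists n, pos sigma (q n)).
    apply/(Weps_shift e N piW).
    pose q' n := q (N + n).
    apply: (winning_from_pos (sigma := sigma) (E := E) (q := q')) => [x a y||n].
    - by move=> sx [[]|[]].
    - by rewrite /q' addn0.
    - by rewrite /q' addnS; exact: qe.
  apply: (Weps_subset W'W); apply: (plays_wins (sigma := tau) (q := q)) => n.
    by have [[sq|[nsq' tq]] _] := Pq n; [case: nsq; exists n | split].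
  by case: (qe n) => [[sq _]|[]//]; case: nsq; exists n.
exists (EpsStrategy E_pos E_edge E_eps E_exists E_adam E_wins); split=> // x sx.
by split=> [|a y]; [left | split=> [sxy|[[]|[]]//]; left].
Qed.

End Extension.

(** * The commitment game *)

Inductive commit_vertex (V T : Type) := Uncommitted of V | Committed of T.
Arguments Uncommitted {V T}.
Arguments Committed {V T}.

Section CommitmentGame.
Variables (C V T : Type) (rep : T -> V -> Prop) (step : T -> C -> T -> Prop).
Variable t0 : T.
Hypothesis rep_exists : forall t, exists v, rep t v.

(* At [v] Eve commits to a [t] that represents [v]; then Adam makes a step from
   [t] and picks a vertex that its target represents, or silently picks another
   vertex that [t] represents. Where no [t] represents [v], all commitments are
   allowed, to avoid sinks. *)
Definition commit_edge (y : commit_vertex V T) (a : option C)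
    (z : commit_vertex V T) : Prop :=
  match y, a, z with
  | Uncommitted v, None, Committed t => (exists t', rep t' v) -> rep t v
  | Committed t, None, Uncommitted v => rep t v
  | Committed t, Some c, Uncommitted v => exists2 t', step t c t' & rep t' v
  | _, _, _ => False
  end.

Lemma commit_no_sink y : exists a z, commit_edge y a z.
Proof.
case: y => [v|t]; exists None.
  have [[t tv]|nv] := EM (exists t, rep t v); first by exists (Committed t).
  by exists (Committed t0).
by have [v tv] := rep_exists t; exists (Uncommitted v).
Qed.

Definition commit_game := Graph commit_no_sink.

Definition commit_eve (y : commit_vertex V T) := exists v, y = Uncommitted v.

(* The states of the strategy pair the element that the play is committed to,
   or that Eve will commit to, with the vertex. *)
Lemma commit_game_won (W : (nat -> C) -> Prop) t v :
  prefix_independent W -> (exists w, W w) -> rep t v ->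
  (forall p c, p 0 = t -> infinite_path step p c -> W c) ->
  exists (S : graph (option C)) (pi : S -> commit_game) (s0 : S),
    @is_strategy _ commit_game commit_eve (Uncommitted v) S pi s0 /\
    winning s0 (Weps W).
Proof.
move=> piW neW tv winW.
pose tracks (x : T * commit_vertex V T) :=
  match x.2 with Uncommitted u => rep x.1 u | Committed s => x.1 = s end.
pose E (x : {x | tracks x}) a (x' : {x | tracks x}) :=
  commit_edge (sval x).2 a (sval x').2 /\
  if a is Some c then step (sval x).1 c (sval x').1
  else (sval x').1 = (sval x).1.
have E_exists x : exists a x', E x a x'.
  case: x => -[s [u|s']] xP; exists None.
    by exists (exist tracks (s, Committed s) erefl); split=> // _; exact: xP.
  have [u su] := rep_exists s; exists (exist tracks (s, Uncommitted u) su).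
  by split=> //=; rewrite -(xP : s = s').
exists (Graph E_exists), (fun x => (sval x).2).
exists (exist tracks (t, Uncommitted v) tv); split; last first.
  move=> p e p0 pe; pose f n := (sval (p n)).1.
  have [inf|ninf] := EM (inf_noneps e); last exact/Weps_eps_tail.
  have [|r [c [r0 rc ec]]] := contract_eps_path (Q := step) (f := f) inf.
    by move=> n; have [_] := pe n.
  by apply/(Weps_proj W inf ec)/(winW (f \o r)); rewrite //= r0 /f p0.
split=> // [x a x' []//|y a z nE yz [[s y'] xP] /= xy]; subst y'.
case: y nE yz xP => [u []|s' _ yz xP]; first by exists u.
have ss' : s = s' := xP; subst s'.
case: a z yz => [c|] [u|//] => [[s' ss' s'u]|su].
  by exists (exist tracks (s', Uncommitted u) s'u); do !split=> //; exists s'.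
by exists (exist tracks (s, Uncommitted u) su).
Qed.

Section CommitStrategy.
Variables (M : Type) (W : (nat -> C) -> Prop).
Variable rho : @eps_strategy C M W commit_game commit_eve set0.
Implicit Types x y : V * M.

Definition commit_pos x :=
  pos rho (Uncommitted x.1, x.2) /\ exists t, rep t x.1.

Definition commit_round x a y := exists2 t,
  plays rho (Uncommitted x.1, x.2) None (Committed t, x.2) &
  plays rho (Committed t, x.2) a (Uncommitted y.1, y.2).

Lemma commit_round_committed x a y : commit_pos x -> commit_round x a y ->
  exists t, [/\ rep t x.1, pos rho (Committed t, x.2),
    plays rho (Uncommitted x.1, x.2) None (Committed t, x.2) &
    plays rho (Committed t, x.2) a (Uncommitted y.1, y.2)].
Proof.
move=> [xpos repx] [t xt ty]; exists t; split=> //.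
  exact: (plays_edge xpos xt).
by have [|] := plays_pos xpos xt.
Qed.

Lemma commit_round_pos x a y :
  commit_pos x -> commit_round x a y -> commit_pos y.
Proof.
move=> xpos /(commit_round_committed xpos)[t [_ tpos _ ty]].
split; first by have [|] := plays_pos tpos ty.
have := plays_edge tpos ty; case: a ty => [c|] _ /= => [[t' _ t'y]|t_y].
  by exists t'.
by exists t.
Qed.

Lemma commit_round_exists x : commit_pos x -> exists t,
  [/\ rep t x.1, forall v, rep t v -> commit_round x None (v, x.2) &
      forall c t' v, step t c t' -> rep t' v ->
        exists k, commit_round x (Some c) (v, k)].
Proof.
case: x => v k [/= vk repv]; have [a [[z k'] vz]] := plays_exists vk.
have := plays_edge vk vz; case: a z vz => [//|] [//|t] vt /= /(_ repv) tv.
have /= kk' := plays_eps vk vt; rewrite -{}kk' in vt.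
have tk : pos rho (Committed t, k) by have [|] := plays_pos vk vt.
have adam a u : commit_edge (Committed t) a (Uncommitted u) ->
    exists2 k', commit_round (v, k) a (u, k') &
      plays rho (Committed t, k) a (Uncommitted u, k').
  move=> tu; have [|k1 tk1] := plays_adam tk _ tu; first by case=> w /=.
  by exists k1 => //; exists t.
exists t; split=> // [u tu|c t' u tt' t'u].
  have [k1 round /(plays_eps tk)/= k_eq] := adam None u tu.
  by rewrite [X in (u, X)]k_eq.
by have [|k1 round _] := adam (Some c) u; [exists t' | exists k1].
Qed.

Lemma commit_round_wins q e : prefix_independent W ->
  (forall n, commit_pos (q n)) -> infinite_path commit_round q e -> Weps W e.
Proof.
move=> piW qpos qe.
have /choice[t tP] n := commit_round_committed (qpos n) (qe n).
pose d n := if odd n then e n./2 else None.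
have proj_d n : fproj d n.*2 = fproj e n.
  elim: n => // n IHn.
  by rewrite doubleS !fprojS IHn /d /= odd_double /= uphalf_double cats0.
apply/(Weps_reindex (d := d) (t := double) piW) => // [n|].
  by rewrite -addnn leq_addr.
pose y n := if odd n then Committed (t n./2) else Uncommitted (q n./2).1.
pose q' n := (y n, (q n./2).2).
apply: (winning_from_pos (sigma := rho) (E := plays rho) (q := q')) => //.
  by have [] := qpos 0.
move=> n; rewrite /q' /y /d /= uphalf_half; have [_ _ xt ty] := tP n./2.
by case: (odd n).
Qed.

End CommitStrategy.

End CommitmentGame.

(** * Extending a strategy *)

Section Region.
Variables (C M : Type) (G S : graph (option C)) (VE : G -> Prop) (v0 : G).
Variables (pi : S -> G) (s0 : S) (A : set S) (exit : set (G * M)).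
Hypothesis strat : is_strategy VE v0 pi s0.
Hypothesis A_closed :
  forall s c s', A s -> cstep s c s' -> A s' \/ exists k, exit (pi s', k).

Definition region_rep (t : {s | A s}) v :=
  exists2 d, eps_reach (sval t) d & pi d = v.

Definition region_step (t : {s | A s}) c (t' : {s | A s}) :=
  cstep (sval t) c (sval t').

Lemma region_rep_self t : region_rep t (pi (sval t)).
Proof. by exists (sval t) => //; exact: eps_refl. Qed.

Lemma region_rep_exists t : exists v, region_rep t v.
Proof. by exists (pi (sval t)); exact: region_rep_self. Qed.

Variable l : {s | A s}.

Definition region_game := commit_game region_step l region_rep_exists.

Lemma region_strategy_of_commit W
    (rho : @eps_strategy C M W region_game (@commit_eve _ _) set0) :
  prefix_independent W ->
  exists tau : eps_strategy W VE exit, forall x, commit_pos rho x -> pos tau x.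
Proof.
move=> piW; have [hom _ adam] := strat.
pose E x a y := [/\ edge x.1 a y.1, a = None -> x.2 = y.2 &
  exit y \/ commit_round rho x a y].
have succ x : commit_pos rho x -> exists2 d, pi d = x.1 &
    forall a d', edge d a d' -> exists k, E x a (pi d', k).
  move=> xpos; have [t [[d td dx] silent colour]] := commit_round_exists xpos.
  exists d => // a d' dd'; have := hom _ _ _ dd'; rewrite dx.
  case: a dd' => [c|] dd' xd'; last first.
    exists x.2; split=> //; right; apply: silent.
    by exists d' => //; exact: eps_step dd'.
  have td' : cstep (sval t) c d' by exists d.
  have [Ad'|[k xk]] := A_closed (svalP t) td'.
    pose t' : {s | A s} := exist A d' Ad'.
    have [k round] := colour c t' (pi d') td' (region_rep_self t').
    by exists k; split=> //; right.
  by exists k; split=> //; left.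
have E_pos x a y : commit_pos rho x -> E x a y -> commit_pos rho y \/ exit y.
  by move=> xpos [_ _ [|/(commit_round_pos xpos)]]; auto.
have E_edge x a y : commit_pos rho x -> E x a y -> edge x.1 a y.1.
  by move=> _ [].
have E_eps x y : commit_pos rho x -> E x None y -> x.2 = y.2.
  by move=> _ [_ /(_ erefl)].
have E_exists x : commit_pos rho x -> exists a y, E x a y.
  move=> /succ[d _ dP]; have [a [d' dd']] := no_sink d.
  by have [k xk] := dP a d' dd'; exists a, (pi d', k).
have E_adam x a v : commit_pos rho x -> ~ VE x.1 -> edge x.1 a v ->
    exists k, E x a (v, k).
  move=> /succ[d dx dP] nE xv; have [d' [<- dd']] := adam _ _ _ nE xv d dx.
  exact: dP.
have E_wins q e : (forall n, commit_pos rho (q n) /\ ~ exit (q n)) ->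
    infinite_path E q e -> Weps W e.
  move=> qP qe; apply: (commit_round_wins (rho := rho) (q := q)) => // n.
    by case: (qP n).
  by have [_ _ [exit_q|//]] := qe n; case: (qP n.+1).
by exists (EpsStrategy E_pos E_edge E_eps E_exists E_adam E_wins).
Qed.

End Region.

Lemma region_strategy (C : Type) (m : nat) (W : (nat -> C) -> Prop)
    (G S : graph (option C)) (VE : G -> Prop) (v0 : G) (pi : S -> G) (s0 : S)
    (A : set S) (exit : set (G * 'I_m)) (l : {s | A s}) :
  is_strategy VE v0 pi s0 ->
  (forall s c s', A s -> cstep s c s' -> A s' \/ exists k, exit (pi s', k)) ->
  prefix_independent W -> eps_memory_le W m -> (exists w, W w) ->
  (forall p c, p 0 = l -> infinite_path (@region_step _ _ A) p c -> W c) ->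
  exists (tau : eps_strategy W VE exit) k, pos tau (pi (sval l), k).
Proof.
move=> strat A_closed piW memW neW winW.
have won := commit_game_won l (region_rep_exists pi (A := A)) piW neW
  (region_rep_self pi l) winW.
have [rho [k rhok]] := eps_strategy_of_has_winning piW (memW _ _ _ won).
have [tau tauP] := region_strategy_of_commit strat A_closed rho piW.
by exists tau, k; apply: tauP; split=> //; exists l; exact: region_rep_self.
Qed.

Definition objective_union (C : Type) (W : nat -> (nat -> C) -> Prop)
    (w : nat -> C) : Prop :=
  exists i, W i w.

Lemma prefix_independent_union (C : Type) (W : nat -> (nat -> C) -> Prop) :
  (forall i, prefix_independent (W i)) ->
  prefix_independent (objective_union W).
Proof. by move=> piW u w; split=> -[i] /piW Ww; exists i => //; apply/piW. Qed.

Lemma eps_strategy_extension (C : Type) (m : nat)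
    (W : nat -> (nat -> C) -> Prop) (G S : graph (option C)) (VE : G -> Prop)
    (v0 : G) (pi : S -> G) (s0 s : S)
    (sigma : closed_strategy 'I_m (objective_union W) VE) :
  (forall i, prefix_independent (W i)) -> (forall i, Sigma02 (W i)) ->
  (forall i, eps_memory_le (W i) m) -> is_strategy VE v0 pi s0 ->
  winning s (Weps (objective_union W)) -> (forall k, ~ pos sigma (pi s, k)) ->
  exists tau, extends sigma tau /\ exists x, pos tau x /\ ~ pos sigma x.
Proof.
move=> piW sW memW strat win_s uncovered_s.
have piU := prefix_independent_union piW.
pose A t :=
  winning t (Weps (objective_union W)) /\ forall k, ~ pos sigma (pi t, k).
have A_closed t c t' :
    A t -> cstep t c t' -> A t' \/ exists k, pos sigma (pi t', k).
  move=> [win_t _] tt'.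
  have [|uncovered_t'] := EM (exists k, pos sigma (pi t', k)); first by right.
  left; split=> [|k t'k]; first exact: winning_cstep tt'.
  by apply: uncovered_t'; exists k.
have win_A p c : infinite_path (@region_step _ _ A) p c -> exists i, W i c.
  move=> pc; have [win_p _] := svalP (p 0).
  exact: (winning_cstep_path (p := sval \o p) win_p).
pose s_A : {t | A t} := exist A s (conj win_s uncovered_s).
have [l [i [neWi win_l]]] :=
  uniform_vertex s_A piW sW (winning_inhabited win_s) win_A.
have [tau [k tauk]] :=
  region_strategy strat A_closed (piW i) (memW i) neWi win_l.
have [w Ww|rho [sigma_rho tau_rho]] := eps_strategy_amalgam tau piU.
  by exists i.
exists rho; split=> //; exists (pi (sval l), k); split; first exact: tau_rho.
by have [_] := svalP l.
Qed.

Theorem theorem6p9 (C : Type) (m : nat) (W : nat -> (nat -> C) -> Prop) :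
  (forall i, prefix_independent (W i)) ->
  (forall i, Sigma02 (W i)) ->
  (forall i, eps_memory_le (W i) m) ->
  eps_memory_le (fun w => exists i, W i w) m.
Proof.
move=> piW sW memW G VE v0 [S [pi [s0 [strat win]]]].
have [sigma max_sigma] := maximal_eps_strategy 'I_m (objective_union W) VE.
have [[k sigma_k]|uncovered] := EM (exists k, pos sigma (pi s0, k)).
  have [_ <- _] := strat.
  by apply: has_winning_eps_strategy_of_pos sigma_k; rewrite card_ord.
have [|tau [sigma_tau [x [tau_x sigma_x]]]] :=
    eps_strategy_extension (sigma := sigma) piW sW memW strat win.
  by move=> k sigma_k; apply: uncovered; exists k.
by have := max_sigma _ sigma_tau _ tau_x.
Qed.
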